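(* Let $X$ be a finite nonabelian simple loop and let $\mathcal V$ be the variety generated by all proper subloops of $X$. Then $X\notin\mathcal V$, and each finitely generated loop in $\mathbf{HSP}(X)$ is isomorphic to $X^k\times Y$ for some $k\ge 0$ and some finite $Y\in\mathcal V$.
   Context: A loop is an algebra $(X,\cdot,\backslash,/,e)$ satisfying $x(x\backslash y)=y=x\backslash(xy)$, $(x/y)y=x=(xy)/y$ and $ex=xe=x$. A normal subloop is the kernel of a loop homomorphism. A loop is abelian if it is an abelian group, and nonabelian otherwise (so a nonabelian loop may be commutative). A loop $X$ is simple if its only normal subloops are $\{e\}$ and $X$. A subloop $A$ of $X$ is proper if $A\ne X$. A variety is an equationally defined class of algebras, and $\mathbf{HSP}(X)$ is the smallest variety (of loops) containing $X$. $X^0$ is the one-element loop. *)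

(* Defs.v *)
From HB Require Import structures.
From mathcomp Require Import all_boot.
From mathcomp Require Import boolp classical_sets functions cardinality.

Set Implicit Arguments.
Unset Strict Implicit.
Unset Printing Implicit Defensive.

Local Open Scope classical_set_scope.
Local Open Scope group_scope.

(* x * y and 1 come from baseUMagmaType (which has no axioms and puts no
   restriction on the carrier); ldiv x y is x \ y and rdiv x y is x / y.  The
   notation x / y of group_scope, which stands for x * y^-1, is not used. *)
HB.mixin Record isLoop X of BaseUMagma X := {
  ldiv : X -> X -> X;
  rdiv : X -> X -> X;
  mulKldiv : forall x y : X, x * ldiv x y = y;
  ldivKmul : forall x y : X, ldiv x (x * y) = y;
  rdivKmul : forall x y : X, rdiv x y * y = x;
  mulKrdiv : forall x y : X, rdiv (x * y) y = x;
  loop_mul1x : forall x : X, 1 * x = x;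
  loop_mulx1 : forall x : X, x * 1 = x
}.

#[short(type="loopType")]
HB.structure Definition Loop := {X of isLoop X & BaseUMagma X}.

Section PairLoop.
Variables X Y : loopType.
Implicit Types u v : (X * Y)%type.

Definition pair_ldiv u v : X * Y := (ldiv u.1 v.1, ldiv u.2 v.2).
Definition pair_rdiv u v : X * Y := (rdiv u.1 v.1, rdiv u.2 v.2).

Fact pair_mulKldiv u v : u * pair_ldiv u v = v.
Proof. by case: u v => [x y] [z t]; congr pair; rewrite /= mulKldiv. Qed.
Fact pair_ldivKmul u v : pair_ldiv u (u * v) = v.
Proof. by case: u v => [x y] [z t]; congr pair; rewrite /= ldivKmul. Qed.
Fact pair_rdivKmul u v : pair_rdiv u v * v = u.
Proof. by case: u v => [x y] [z t]; congr pair; rewrite /= rdivKmul. Qed.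
Fact pair_mulKrdiv u v : pair_rdiv (u * v) v = u.
Proof. by case: u v => [x y] [z t]; congr pair; rewrite /= mulKrdiv. Qed.
Fact pair_mul1x u : 1 * u = u.
Proof. by case: u => [x y]; congr pair; rewrite /= loop_mul1x. Qed.
Fact pair_mulx1 u : u * 1 = u.
Proof. by case: u => [x y]; congr pair; rewrite /= loop_mulx1. Qed.

HB.instance Definition _ := isLoop.Build (X * Y)%type
  pair_mulKldiv pair_ldivKmul pair_rdivKmul pair_mulKrdiv
  pair_mul1x pair_mulx1.
End PairLoop.

(* In particular X ^ k, which is {ffun 'I_k -> X}, is a loop. *)
Section FfunLoop.
Variables (I : finType) (X : loopType).
Implicit Types f g : {ffun I -> X}.

Definition ffun_ldiv f g := [ffun i => ldiv (f i) (g i)].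
Definition ffun_rdiv f g := [ffun i => rdiv (f i) (g i)].

Fact ffun_mulKldiv f g : f * ffun_ldiv f g = g.
Proof. by apply/ffunP=> i; rewrite !ffunE mulKldiv. Qed.
Fact ffun_ldivKmul f g : ffun_ldiv f (f * g) = g.
Proof. by apply/ffunP=> i; rewrite !ffunE ldivKmul. Qed.
Fact ffun_rdivKmul f g : ffun_rdiv f g * g = f.
Proof. by apply/ffunP=> i; rewrite !ffunE rdivKmul. Qed.
Fact ffun_mulKrdiv f g : ffun_rdiv (f * g) g = f.
Proof. by apply/ffunP=> i; rewrite !ffunE mulKrdiv. Qed.
Fact ffun_loop_mul1x f : 1 * f = f.
Proof. by apply/ffunP=> i; rewrite !ffunE loop_mul1x. Qed.
Fact ffun_loop_mulx1 f : f * 1 = f.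
Proof. by apply/ffunP=> i; rewrite !ffunE loop_mulx1. Qed.

HB.instance Definition _ := isLoop.Build {ffun I -> X}
  ffun_mulKldiv ffun_ldivKmul ffun_rdivKmul ffun_mulKrdiv
  ffun_loop_mul1x ffun_loop_mulx1.
End FfunLoop.

(* An associative loop is a group. *)
Definition loop_abelian (X : loopType) : Prop :=
  associative (@mul X) /\ commutative (@mul X).

Record loop_morphism (X Y : loopType) (f : X -> Y) : Prop := {
  morph_mul : forall x y, f (x * y) = f x * f y;
  morph_ldiv : forall x y, f (ldiv x y) = ldiv (f x) (f y);
  morph_rdiv : forall x y, f (rdiv x y) = rdiv (f x) (f y);
  morph_one : f 1 = 1
}.

Definition loop_isomorphic (X Y : loopType) : Prop :=
  exists f : X -> Y, loop_morphism f /\ bijective f.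

Definition normal_subloop (X : loopType) (N : set X) : Prop :=
  exists (Y : loopType) (f : X -> Y),
    loop_morphism f /\ N = [set x | f x = 1].

Definition loop_simple (X : loopType) : Prop :=
  forall N : set X, normal_subloop N -> N = [set 1] \/ N = [set: X].

Record subloop (X : loopType) := Subloop {
  subloop_set :> set X;
  subloop1 : subloop_set 1;
  subloopM : forall x y,
    subloop_set x -> subloop_set y -> subloop_set (x * y);
  subloop_ldiv : forall x y,
    subloop_set x -> subloop_set y -> subloop_set (ldiv x y);
  subloop_rdiv : forall x y,
    subloop_set x -> subloop_set y -> subloop_set (rdiv x y)
}.

Definition subloop_proper (X : loopType) (A : subloop X) : Prop :=
  (A : set X) <> [set: X].

Definition finitely_generated (X : loopType) : Prop :=
  exists S : set X, finite_set S /\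
    forall A : subloop X, S `<=` A -> (A : set X) = [set: X].

(* An alias of set_type, which depends on the closure properties of A and can
   thus carry the induced loop structure. *)
Definition subloop_type (X : loopType) (A : subloop X) : Type := set_type A.

Section SubloopLoop.
Variables (X : loopType) (A : subloop X).
Local Notation T := (subloop_type A).
Implicit Types u v : T.

Definition sub_one : T := exist _ 1 (mem_set (subloop1 A)).
Definition sub_mul u v : T :=
  exist _ (val u * val v)
    (mem_set (subloopM (set_mem (valP u)) (set_mem (valP v)))).
Definition sub_ldiv u v : T :=
  exist _ (ldiv (val u) (val v))
    (mem_set (subloop_ldiv (set_mem (valP u)) (set_mem (valP v)))).
Definition sub_rdiv u v : T :=
  exist _ (rdiv (val u) (val v))
    (mem_set (subloop_rdiv (set_mem (valP u)) (set_mem (valP v)))).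

HB.instance Definition _ := hasMul.Build T sub_mul.
HB.instance Definition _ := hasOne.Build T sub_one.

Fact sub_mulKldiv u v : u * sub_ldiv u v = v.
Proof. by apply: val_inj; rewrite /= mulKldiv. Qed.
Fact sub_ldivKmul u v : sub_ldiv u (u * v) = v.
Proof. by apply: val_inj; rewrite /= ldivKmul. Qed.
Fact sub_rdivKmul u v : sub_rdiv u v * v = u.
Proof. by apply: val_inj; rewrite /= rdivKmul. Qed.
Fact sub_mulKrdiv u v : sub_rdiv (u * v) v = u.
Proof. by apply: val_inj; rewrite /= mulKrdiv. Qed.
Fact sub_mul1x u : 1 * u = u.
Proof. by apply: val_inj; rewrite /= loop_mul1x. Qed.
Fact sub_mulx1 u : u * 1 = u.
Proof. by apply: val_inj; rewrite /= loop_mulx1. Qed.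

HB.instance Definition _ := isLoop.Build T
  sub_mulKldiv sub_ldivKmul sub_rdivKmul sub_mulKrdiv sub_mul1x sub_mulx1.
End SubloopLoop.

Inductive loop_term : Type :=
  | tvar of nat
  | tone
  | tmul of loop_term & loop_term
  | tldiv of loop_term & loop_term
  | trdiv of loop_term & loop_term.

Fixpoint eval (X : loopType) (e : nat -> X) (t : loop_term) : X :=
  match t with
  | tvar n => e n
  | tone => 1
  | tmul s t => eval e s * eval e t
  | tldiv s t => ldiv (eval e s) (eval e t)
  | trdiv s t => rdiv (eval e s) (eval e t)
  end.

Definition satisfies (X : loopType) (s t : loop_term) : Prop :=
  forall e : nat -> X, eval e s = eval e t.

Definition is_variety (K : loopType -> Prop) : Prop :=
  exists E : loop_term -> loop_term -> Prop,
    forall X : loopType, K X <-> (forall s t, E s t -> satisfies X s t).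

(* The smallest variety containing the class C, as the intersection of all of
   them. *)
Definition generated_variety (C : loopType -> Prop) (X : loopType) : Prop :=
  forall K, is_variety K -> (forall Y, C Y -> K Y) -> K X.

Definition HSP (X : loopType) : loopType -> Prop :=
  generated_variety (fun Y => Y = X).

Definition proper_subloop_variety (X : loopType) : loopType -> Prop :=
  generated_variety (fun Y =>
    exists A : subloop X, subloop_proper A /\ Y = (subloop_type A : loopType)).

(* Main.v *)
(* An assignment e of elements of a loop M to the variables is identified with
   the kernel of t |-> eval e t on terms; these kernels permute (Mal'cev), and
   no free loop is needed.  Since X is simple and nonabelian, a kernel with
   quotient X is prime: if it contains the intersection of two kernels, then it
   contains one of them.  If X satisfied the identities of its proper subloops,
   a kernel with quotient X would contain a finite intersection of kernels with
   quotient a proper subloop, hence one of these, and X would be a quotient of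
   a proper subloop.  If L is finitely generated in HSP(X), its kernel contains
   a finite intersection of kernels of assignments into X; removing them one at
   a time either changes nothing or splits off a direct factor X of L, until
   only those with quotient a proper subloop are left. *)
Require Import Defs.
From HB Require Import structures.
From mathcomp Require Import all_boot.
From mathcomp Require Import boolp classical_sets functions cardinality.

Local Open Scope classical_set_scope.

(** * Finite sets, injections and bijections *)

Lemma finite_enumeration (T : Type) (A : set T) :
  finite_set A -> exists n (x : 'I_n -> T), A = range x.
Proof.
elim/Pchoice: T => T in A *.
move=> /finite_seqP[s ->]; exists (size s), (tnth (in_tuple s)).
apply/seteqP; split=> y /=.
  by move/(@tnthP _ _ (in_tuple s))=> [i ->]; exists i.
by case=> i _ <-; exact: (mem_tnth i (in_tuple s)).
Qed.

Lemma finite_bijection (T : Type) :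
  finite_set [set: T] -> exists n (x : 'I_n -> T), bijective x.
Proof.
case=> n finT; exists n.
have /card_bijP[f [g fK gK]] : ([set: T] #= [set: 'I_n])%card.
  exact: card_eq_trans finT card_II.
pose toT (U : Type) (u : U) : [set: U] := exist _ u (mem_setT u).
have toTK U (u : [set: U]) : toT U (val u) = u by apply: val_inj.
exists (fun i => val (g (toT _ i))), (fun y => val (f (toT _ y))) => u.
  by rewrite toTK gK.
by rewrite toTK fK.
Qed.

Lemma finite_injection {T U : Type} (f : T -> U) :
  injective f -> finite_set [set: U] -> finite_set [set: T].
Proof.
move=> injf finU; have := @finite_preimage _ _ [set: U] f.
by rewrite preimage_setT; apply=> // x y _ _ /injf.
Qed.

Lemma finite_inj_surj {T : Type} (g : T -> T) :
  finite_set [set: T] -> injective g -> forall y, exists x, g x = y.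
Proof.
move=> /finite_bijection[n [x [x' xK x'K]]] injg y.
have injh : injective (x' \o g \o x).
  exact: inj_comp (inj_comp (can_inj x'K) injg) (can_inj xK).
exists (x (invF injh (x' y))).
by apply: (can_inj x'K); exact: (f_invF injh (x' y)).
Qed.

Lemma bijective_inj_surj {T U : Type} (f : T -> U) :
  injective f -> (forall y, exists x, f x = y) -> bijective f.
Proof.
move=> injf /choice[g fgK]; exists g => // x.
by apply: injf; rewrite fgK.
Qed.

Section LoopTheory.
Set Implicit Arguments.
Unset Strict Implicit.
Unset Printing Implicit Defensive.
Local Open Scope group_scope.

(** * Cancellation, morphisms and evaluation of terms *)

Lemma loop_mulI (X : loopType) (x y z : X) : x * y = x * z -> y = z.
Proof. by move=> e; rewrite -(ldivKmul x y) e ldivKmul. Qed.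

Lemma loop_mulIr (X : loopType) (x y z : X) : y * x = z * x -> y = z.
Proof. by move=> e; rewrite -(mulKrdiv y x) e mulKrdiv. Qed.

Lemma ldivxx (X : loopType) (x : X) : ldiv x x = 1.
Proof. by apply: (@loop_mulI _ x); rewrite mulKldiv loop_mulx1. Qed.

Lemma ldiv_eq1 (X : loopType) (x y : X) : ldiv x y = 1 -> x = y.
Proof. by move=> e; rewrite -[RHS](mulKldiv x) e loop_mulx1. Qed.

Lemma loop_morphism_mul (X Y : loopType) (f : X -> Y) :
  (forall x y, f (x * y) = f x * f y) -> loop_morphism f.
Proof.
move=> fM; split=> // [x y|x y|].
- by apply: (@loop_mulI _ (f x)); rewrite mulKldiv -fM mulKldiv.
- by apply: (@loop_mulIr _ (f y)); rewrite rdivKmul -fM rdivKmul.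
- by apply: (@loop_mulI _ (f 1)); rewrite -fM !loop_mulx1.
Qed.

Lemma eval_morphism (X Y : loopType) (f : X -> Y) (e : nat -> X) t :
  loop_morphism f -> f (eval e t) = eval (f \o e) t.
Proof.
by case=> fM fl fr f1; elim: t => //= s es t et; rewrite ?fM ?fl ?fr es et.
Qed.

Definition pair_assignment (X Y : loopType) (a : nat -> X) (b : nat -> Y) :
  nat -> X * Y := fun k => (a k, b k).

Lemma eval_pair (X Y : loopType) (a : nat -> X) (b : nat -> Y) t :
  eval (pair_assignment a b) t = (eval a t, eval b t).
Proof. by elim: t => //= s -> t ->. Qed.

Lemma eval_pairP (X Y : loopType) (a : nat -> X) (b : nat -> Y) s t :
  eval (pair_assignment a b) s = eval (pair_assignment a b) t <->
  eval a s = eval a t /\ eval b s = eval b t.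
Proof. by rewrite !eval_pair; split=> [[]|[-> ->]]. Qed.

Lemma val_subloop_morphism (X : loopType) (A : subloop X) :
  loop_morphism (val : subloop_type A -> X).
Proof. by apply: loop_morphism_mul. Qed.

(** * Substitution, generating assignments and identities *)

Fixpoint tsubst (u : nat -> loop_term) (t : loop_term) : loop_term :=
  match t with
  | tvar n => u n
  | tone => tone
  | tmul s t => tmul (tsubst u s) (tsubst u t)
  | tldiv s t => tldiv (tsubst u s) (tsubst u t)
  | trdiv s t => trdiv (tsubst u s) (tsubst u t)
  end.

Lemma eval_tsubst (X : loopType) (e : nat -> X) u t :
  eval e (tsubst u t) = eval (fun k => eval e (u k)) t.
Proof. by elim: t => //= s -> t ->. Qed.

Definition generates (X : loopType) (e : nat -> X) : Prop :=
  forall x, exists t, eval e t = x.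

Definition range_subloop (X : loopType) (e : nat -> X) : subloop X.
Proof.
exists (range (eval e)).
- by exists tone.
- by move=> _ _ [s _ <-] [t _ <-]; exists (tmul s t).
- by move=> _ _ [s _ <-] [t _ <-]; exists (tldiv s t).
- by move=> _ _ [s _ <-] [t _ <-]; exists (trdiv s t).
Defined.

Lemma range_subloop_proper (X : loopType) (e : nat -> X) :
  ~ generates e -> subloop_proper (range_subloop e).
Proof.
move=> nge eqT; apply: nge => x.
by have : [set: X] x by []; rewrite -eqT => -[t _ <-]; exists t.
Qed.

(** The kernel inclusion makes [Y] a quotient of the subloop generated by [a]. Every assignment into
    [Y] is a substitution followed by [f], and an identity of [X] survives that substitution under
    [a]. *)
Lemma satisfies_generated (X Y : loopType) (a : nat -> X) (f : nat -> Y) :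
    generates f ->
    (forall s t, eval a s = eval a t -> eval f s = eval f t) ->
  forall s t, satisfies X s t -> satisfies Y s t.
Proof.
move=> /choice[u fu] sub s t Xst e.
have -> : e = fun k => eval f (u (e k)) by apply/funext=> k; rewrite fu.
by rewrite -!(eval_tsubst f (u \o e)); apply: sub; rewrite !eval_tsubst.
Qed.

Lemma finite_generated (X Y : loopType) (a : nat -> X) (f : nat -> Y) :
    generates f ->
    (forall s t, eval a s = eval a t -> eval f s = eval f t) ->
  finite_set [set: X] -> finite_set [set: Y].
Proof.
move=> /choice[u fu] sub; apply: (@finite_injection _ _ (eval a \o u)).
by move=> x y /sub; rewrite !fu.
Qed.

(** It suffices to test single identities, because the models of one identity already form a
    variety. *)
Lemma generated_varietyP (C : loopType -> Prop) (X : loopType) :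
  generated_variety C X <->
  (forall s t, (forall Y, C Y -> satisfies Y s t) -> satisfies X s t).
Proof.
split=> [VX s t Cst|Xsat K [E KE] CK].
- apply: (VX (fun Y => satisfies Y s t)) => //.
  exists (fun s' t' => s' = s /\ t' = t) => Y.
  by split=> [Yst _ _ [-> ->]//|]; apply.
- by apply/KE=> s t Est; apply: Xsat => Y /CK/KE; apply.
Qed.

Lemma satisfies_prod (X Y : loopType) s t :
  satisfies X s t -> satisfies Y s t -> satisfies (X * Y)%type s t.
Proof.
move=> Xst Yst e.
have -> : e = pair_assignment (fst \o e) (snd \o e).
  by apply/funext=> k; rewrite /pair_assignment /=; case: (e k).
by apply/eval_pairP; split; [exact: Xst | exact: Yst].
Qed.

Lemma generated_variety_prod (C : loopType -> Prop) (X Y : loopType) :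
  generated_variety C X -> generated_variety C Y ->
  generated_variety C (X * Y)%type.
Proof.
move=> /generated_varietyP VX /generated_varietyP VY.
apply/generated_varietyP=> s t Cst.
by apply: satisfies_prod; [exact: VX | exact: VY].
Qed.

(** * Congruences and quotient loops *)

Record congruence (X : loopType) := Congruence {
  congr_rel :> X -> X -> Prop;
  congr_refl : forall x, congr_rel x x;
  congr_sym : forall x y, congr_rel x y -> congr_rel y x;
  congr_trans : forall x y z, congr_rel x y -> congr_rel y z -> congr_rel x z;
  congrM : forall x y z t,
    congr_rel x y -> congr_rel z t -> congr_rel (x * z) (y * t);
  congr_ldiv : forall x y z t,
    congr_rel x y -> congr_rel z t -> congr_rel (ldiv x z) (ldiv y t);
  congr_rdiv : forall x y z t,
    congr_rel x y -> congr_rel z t -> congr_rel (rdiv x z) (rdiv y t)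
}.

Section Quotient.
Variables (X : loopType) (R : congruence X).

(** Classes are predicates, so that congruent elements have equal classes by extensionality. *)
Definition quotient : Type := {c : X -> Prop | exists x, c = R x}.
Definition class_of (x : X) : quotient := exist _ (R x) (ex_intro _ x erefl).
Definition repr (c : quotient) : X := projT1 (cid (projT2 c)).

Lemma class_ofP x y : class_of x = class_of y <-> R x y.
Proof.
split=> [[exy]|Rxy]; first by rewrite exy; exact: congr_refl.
apply: eq_exist; apply/funext=> z; apply/propext.
by split; apply: congr_trans => //; exact: congr_sym.
Qed.

Lemma reprK c : class_of (repr c) = c.
Proof.
rewrite /repr; case: cid => x /= ex; case: c ex => c cP /= ex.
exact: eq_exist.
Qed.

Lemma repr_class x : R (repr (class_of x)) x.
Proof. by apply/class_ofP; rewrite reprK. Qed.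

Definition quotient_one := class_of 1.
Definition quotient_mul c d := class_of (repr c * repr d).
Definition quotient_ldiv c d := class_of (ldiv (repr c) (repr d)).
Definition quotient_rdiv c d := class_of (rdiv (repr c) (repr d)).

HB.instance Definition _ := hasMul.Build quotient quotient_mul.
HB.instance Definition _ := hasOne.Build quotient quotient_one.

Lemma class_ofM x y : class_of (x * y) = class_of x * class_of y.
Proof.
by apply/class_ofP/congrM; apply: congr_sym; exact: repr_class.
Qed.

Lemma class_of_ldiv x y :
  class_of (ldiv x y) = quotient_ldiv (class_of x) (class_of y).
Proof.
by apply/class_ofP/congr_ldiv; apply: congr_sym; exact: repr_class.
Qed.

Lemma class_of_rdiv x y :
  class_of (rdiv x y) = quotient_rdiv (class_of x) (class_of y).
Proof.
by apply/class_ofP/congr_rdiv; apply: congr_sym; exact: repr_class.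
Qed.

Fact quotient_mulKldiv c d : c * quotient_ldiv c d = d.
Proof.
by rewrite -(reprK c) -(reprK d) -class_of_ldiv -class_ofM mulKldiv.
Qed.
Fact quotient_ldivKmul c d : quotient_ldiv c (c * d) = d.
Proof.
by rewrite -(reprK c) -(reprK d) -class_ofM -class_of_ldiv ldivKmul.
Qed.
Fact quotient_rdivKmul c d : quotient_rdiv c d * d = c.
Proof.
by rewrite -(reprK c) -(reprK d) -class_of_rdiv -class_ofM rdivKmul.
Qed.
Fact quotient_mulKrdiv c d : quotient_rdiv (c * d) d = c.
Proof.
by rewrite -(reprK c) -(reprK d) -class_ofM -class_of_rdiv mulKrdiv.
Qed.
Fact quotient_mul1x (c : quotient) : 1 * c = c.
Proof. by rewrite -(reprK c) -class_ofM loop_mul1x. Qed.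
Fact quotient_mulx1 (c : quotient) : c * 1 = c.
Proof. by rewrite -(reprK c) -class_ofM loop_mulx1. Qed.

HB.instance Definition _ := isLoop.Build quotient
  quotient_mulKldiv quotient_ldivKmul quotient_rdivKmul quotient_mulKrdiv
  quotient_mul1x quotient_mulx1.

Lemma class_of_morphism : loop_morphism class_of.
Proof. exact: loop_morphism_mul class_ofM. Qed.
End Quotient.

(** * The join of two kernels *)

Section Join.
Variables (Y M : loopType) (f : nat -> Y) (m : nat -> M).
Hypothesis gf : generates f.

(** This is the image in [Y] of the kernel of [m]; pulled back to terms, it is the join of the
    kernels of [f] and [m]. *)
Definition join_rel (y z : Y) : Prop :=
  exists s t, [/\ eval f s = y, eval f t = z & eval m s = eval m t].

Lemma join_rel_trans x y z : join_rel x y -> join_rel y z -> join_rel x z.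
Proof.
move=> [s [t [<- <- st]]] [t' [u [ft' <- t'u]]].
(* Mal'cev term: [f] identifies [t] with [t'], which leaves [s], while [m] identifies [s] with [t],
   which leaves [t']. *)
exists (tmul s (tldiv t t')), u; split=> //=.
- by rewrite ft' ldivxx loop_mulx1.
- by rewrite st mulKldiv.
Qed.

Definition join_congruence : congruence Y.
Proof.
exists join_rel.
- by move=> x; have [t <-] := gf x; exists t, t.
- by move=> x y [s [t [<- <- e]]]; exists t, s.
- exact: join_rel_trans.
- move=> _ _ _ _ [s [t [<- <- st]]] [u [v [<- <- uv]]].
  by exists (tmul s u), (tmul t v); rewrite /= st uv.
- move=> _ _ _ _ [s [t [<- <- st]]] [u [v [<- <- uv]]].
  by exists (tldiv s u), (tldiv t v); rewrite /= st uv.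
- move=> _ _ _ _ [s [t [<- <- st]]] [u [v [<- <- uv]]].
  by exists (trdiv s u), (trdiv t v); rewrite /= st uv.
Defined.
End Join.

(** * Primeness and direct factors for a nonabelian simple loop *)

Section Simple.
Variables (X : loopType) (nonabX : ~ loop_abelian X) (simX : loop_simple X).

(** A loop congruence is determined by the class of 1, which is a normal subloop: [x] and [y] are
    congruent exactly when [ldiv x y] is congruent to 1. *)
Lemma simple_congruence (R : congruence X) :
  (forall x y, R x y -> x = y) \/ (forall x y, R x y).
Proof.
have [|ker1|kerT] := @simX [set x | class_of R x = 1].
- by exists (quotient R), (class_of R); split=> //; exact: class_of_morphism.
- left=> x y /class_ofP exy; apply: ldiv_eq1.
  have : [set x | class_of R x = 1] (ldiv x y).
    by rewrite /= (morph_ldiv (class_of_morphism R)) exy ldivxx.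
  by rewrite ker1.
- right=> x y; apply/class_ofP.
  have k z : class_of R z = 1.
    by have : [set: X] z by []; rewrite -kerT.
  by rewrite !k.
Qed.

(** The image in [X] of the kernel of [a] is a congruence other than equality, hence relates
    everything; a Mal'cev term turns this full join into a composition of the two kernels. *)
Lemma simple_permute (A : loopType) (f : nat -> X) (a : nat -> A) :
    generates f ->
    ~ (forall s t, eval a s = eval a t -> eval f s = eval f t) ->
  forall s t, exists u, eval f u = eval f s /\ eval a u = eval a t.
Proof.
move=> gf nsub s t.
case: (simple_congruence (join_congruence a gf)) => [eqR|totR].
  by case: nsub => s' t' est; apply: eqR; exists s', t'.
have [s' [t' [fs ft a_st]]] := totR (eval f s) (eval f t).
(* Under [f], [t] and [t'] cancel and leave [s']; under [a], [t'] and [s'] cancel and leave [t]. *)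
exists (tmul t (tldiv t' s')) => /=.
by rewrite fs ft mulKldiv a_st ldivxx loop_mulx1.
Qed.

(* Otherwise, every element of X would be the value of a
   term killed by a and of a term killed by b; such elements commute and
   associate, because they do so modulo each kernel. *)
Lemma simple_prime (A B : loopType) (f : nat -> X) (a : nat -> A)
    (b : nat -> B) :
    generates f ->
    (forall s t, eval a s = eval a t -> eval b s = eval b t ->
      eval f s = eval f t) ->
  (forall s t, eval a s = eval a t -> eval f s = eval f t) \/
  (forall s t, eval b s = eval b t -> eval f s = eval f t).
Proof.
move=> gf sub; apply: contrapT => /not_orP[na nb]; apply: nonabX.
have ha x : exists u, eval f u = x /\ eval a u = 1.
  have [s <-] := gf x.
  by have [u [fu au]] := simple_permute gf na s tone; exists u.
have hb x : exists u, eval f u = x /\ eval b u = 1.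
  have [s <-] := gf x.
  by have [u [fu bu]] := simple_permute gf nb s tone; exists u.
split=> [x y z|x y].
- have [u [<- au]] := ha x; have [v [<- bv]] := hb y.
  have [w [<- aw]] := ha z.
  apply: (sub (tmul u (tmul v w)) (tmul (tmul u v) w)) => /=.
    by rewrite au aw !loop_mul1x.
  by rewrite bv loop_mul1x loop_mulx1.
- have [u [<- au]] := ha x; have [v [<- bv]] := hb y.
  apply: (sub (tmul u v) (tmul v u)) => /=.
    by rewrite au loop_mul1x loop_mulx1.
  by rewrite bv loop_mul1x loop_mulx1.
Qed.

Lemma simple_nontrivial : ~ (forall x y : X, x = y).
Proof. by move=> triv; apply: nonabX; split=> [x y z|x y]; exact: triv. Qed.

(** Pairing assignments into a product lets the binary [simple_prime] be iterated over a finite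
    family. *)
Lemma intersection_kernels (I : eqType) (E : I -> nat -> X) (r : seq I) :
  exists (B : loopType) (b : nat -> B), forall s t,
    eval b s = eval b t <->
    (forall i, i \in r -> eval (E i) s = eval (E i) t).
Proof.
elim: r => [|i r [B [b bP]]].
  exists (X ^ 0)%type, (fun=> 1) => s t; split=> // _.
  by apply/ffunP=> -[].
exists (X * B)%type, (pair_assignment (E i) b) => s t.
split=> [/eval_pairP[ei /bP er] j|er].
  by rewrite in_cons => /predU1P[->|/er].
apply/eval_pairP; split; first by apply: er; rewrite mem_head.
by apply/bP=> j jr; apply: er; rewrite in_cons jr orbT.
Qed.

Lemma simple_prime_seq (I : eqType) (E : I -> nat -> X) (r : seq I)
    (f : nat -> X) :
    generates f ->
    (forall s t, (forall i, i \in r -> eval (E i) s = eval (E i) t) ->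
      eval f s = eval f t) ->
  exists2 i, i \in r &
    forall s t, eval (E i) s = eval (E i) t -> eval f s = eval f t.
Proof.
move=> gf; elim: r => [sub|i r IHr sub].
  (* The empty intersection relates all terms, so [X] would be trivial. *)
  case: simple_nontrivial => x y.
  by have [s <-] := gf x; have [t <-] := gf y; exact: sub.
have [B [b bP]] := intersection_kernels E r.
have [|sub_i|sub_r] := @simple_prime _ _ f (E i) b gf.
- move=> s t ei /bP er; apply: sub => j.
  by rewrite in_cons => /predU1P[->|/er].
- by exists i; rewrite ?mem_head.
- have [|j jr subj] := IHr; first by move=> s t /bP; exact: sub_r.
  by exists j; rewrite // in_cons jr orbT.
Qed.

(** Together [h] and [q] identify [Y] with the product of [X] and [Y']. In the new power, coordinate
    [ord0] carries [h], and the others, reached through [lift], carry the old power. *)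
Lemma isomorphic_power_step (Y Y' W : loopType) (k : nat) (h : Y -> X)
    (q : Y -> Y') :
    loop_morphism h -> loop_morphism q ->
    (forall y z, h y = h z -> q y = q z -> y = z) ->
    (forall x y', exists y, h y = x /\ q y = y') ->
  loop_isomorphic Y' (X ^ k * W)%type ->
  loop_isomorphic Y (X ^ k.+1 * W)%type.
Proof.
move=> hM qM inj surj [g [gM [g' gK g'K]]].
pose F y : (X ^ k.+1 * W)%type :=
  ([ffun i => if unlift ord0 i is Some j then (g (q y)).1 j else h y],
   (g (q y)).2).
exists F; split.
  apply: loop_morphism_mul => x y; rewrite /F.
  rewrite (morph_mul qM) (morph_mul gM) (morph_mul hM).
  congr pair; apply/ffunP=> i; rewrite !ffunE.
  by case: (unlift ord0 i) => // j; rewrite ffunE.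
apply: bijective_inj_surj => [y z [/ffunP eF e2]|[u w]].
  apply: inj; first by have := eF ord0; rewrite !ffunE unlift_none.
  apply: (can_inj gK); rewrite [LHS]surjective_pairing [RHS]surjective_pairing.
  congr pair => //; apply/ffunP=> j.
  by have := eF (lift ord0 j); rewrite !ffunE liftK.
have [y [hy qy]] := surj (u ord0) (g' ([ffun j => u (lift ord0 j)], w)).
exists y; rewrite /F qy g'K hy /=; congr pair; apply/ffunP=> i.
by rewrite ffunE; case: unliftP => [j ->|->//]; rewrite ffunE.
Qed.

(* The induction step splits off the first kernel.  Let theta be the
   intersection of the others.  Unless one of the two kernels is redundant, the
   kernel of f lies below that of E i by primeness and modularity, and theta
   and the kernel of E i permute with full join, so Y is the product of X and
   the quotient of Y by the image of theta. *)
Lemma decomposition (I : eqType) (E : I -> nat -> X) (r : seq I)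
    (finX : finite_set [set: X]) (Z Y : loopType) (z : nat -> Z)
    (f : nat -> Y) :
    proper_subloop_variety X Z -> finite_set [set: Z] -> generates f ->
    (forall s t, (forall i, i \in r -> eval (E i) s = eval (E i) t) ->
      eval z s = eval z t -> eval f s = eval f t) ->
  exists (k : nat) (W : loopType),
    [/\ finite_set [set: W], proper_subloop_variety X W
      & loop_isomorphic Y (X ^ k * W)%type].
Proof.
elim: r Z Y z f => [|i r IHr] Z Y z f VZ finZ gf sub.
  have subz s t : eval z s = eval z t -> eval f s = eval f t.
    by move=> ez; apply: sub.
  exists 0%N, Y; split.
  - exact: finite_generated gf subz finZ.
  - move/generated_varietyP: VZ => VZ; apply/generated_varietyP=> s t Cst.
    exact: satisfies_generated gf subz s t (VZ s t Cst).
  - exists (fun y => (1, y)); split.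
      by apply: loop_morphism_mul => x y; congr pair; rewrite loop_mul1x.
    exists snd => // -[u y]; congr pair; by apply/ffunP=> -[].
(* If [E i] does not generate [X], it takes values in a proper subloop, and its kernel is absorbed
   into that of [z]. *)
have [gi|/range_subloop_proper properA] := pselect (generates (E i)); last first.
  pose A := range_subloop (E i).
  have Ei_in k : (A : set X) (E i k) by exists (tvar k).
  pose a k : subloop_type A := exist _ (E i k) (mem_set (Ei_in k)).
  have aP s t : eval a s = eval a t -> eval (E i) s = eval (E i) t.
    move=> /(congr1 val).
    by rewrite !(eval_morphism _ _ (val_subloop_morphism A)).
  apply: (IHr (subloop_type A * Z)%type Y (pair_assignment a z) f) => //.
  - apply: generated_variety_prod => //.
    by move=> K _; apply; exists A.
  - rewrite -setXTT; apply: finite_setX => //.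
    exact: (finite_injection val val_inj).
  - move=> s t er /eval_pairP[/aP ei ez]; apply: sub => // j.
    by rewrite in_cons => /predU1P[->|/er].
have [B [b bP]] := intersection_kernels E r.
pose m := pair_assignment b z.
have mP s t : eval m s = eval m t <->
    (forall j, j \in r -> eval (E j) s = eval (E j) t) /\
    eval z s = eval z t.
  by split=> [/eval_pairP[/bP]|[/bP eb ez]] //; apply/eval_pairP.
have sub' s t : eval (E i) s = eval (E i) t -> eval m s = eval m t ->
    eval f s = eval f t.
  move=> ei /mP[er ez]; apply: sub => // j.
  by rewrite in_cons => /predU1P[->|/er].
have [subm|nsubm] :=
  pselect (forall s t, eval m s = eval m t -> eval f s = eval f t).
  by apply: (IHr Z Y z f) => // s t er ez; apply: subm; apply/mP.
have nsubmi : ~ (forall s t, eval m s = eval m t ->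
    eval (E i) s = eval (E i) t).
  by move=> smi; apply: nsubm => s t em; apply: sub' => //; exact: smi.
have subfi s t : eval f s = eval f t -> eval (E i) s = eval (E i) t.
  move: s t; apply: contrapT => nsubfi; apply: nsubm => s t em.
  have nsubfm : ~ (forall s t,
      eval (pair_assignment f m) s = eval (pair_assignment f m) t ->
      eval (E i) s = eval (E i) t).
    move=> sfm; case: (@simple_prime _ _ (E i) f m gi) => // s' t' ef em'.
    by apply: sfm; apply/eval_pairP.
  (* The term [u] agrees with [s] under [f] and [m], and with [t] under [E i]. Since [m] also
     identifies [s] and [t], [sub'] gives that [f] identifies [u] and [t]. *)
  have [u [eiu /eval_pairP[fu mu]]] := simple_permute gi nsubfm t s.
  by rewrite -fu; apply: sub' => //; rewrite mu.
have [rep repK] := choice gf.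
(* [E i] factors through [f]; by [subfi] the resulting map does not depend on the chosen
   representatives. *)
pose h y := eval (E i) (rep y).
have hE t : h (eval f t) = eval (E i) t by apply: subfi; rewrite repK.
have hM : loop_morphism h.
  apply: loop_morphism_mul => x y.
  by have [s <-] := gf x; have [t <-] := gf y; rewrite (hE (tmul s t)) !hE.
pose R := join_congruence m gf.
have qM := class_of_morphism R.
have qf t : class_of R (eval f t) = eval (class_of R \o f) t.
  exact: eval_morphism qM.
have [|s t er ez|k [W [finW VW isoW]]] :=
  IHr Z (quotient R : loopType) z (class_of R \o f) VZ finZ.
- move=> c; have [t ft] := gf (repr c).
  by exists t; rewrite -qf ft reprK.
- by rewrite -!qf; apply/class_ofP; exists s, t; split=> //; apply/mP.
exists k.+1, W; split=> //.
apply: (@isomorphic_power_step Y _ W k h (class_of R)) => //.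
- move=> y y' hy /class_ofP[s [t [fs ft em]]].
  by rewrite -fs -ft; apply: sub' => //; rewrite -!hE fs ft.
- move=> x c; have [s xs] := gi x; have [t ft] := gf (repr c).
  have [u [eiu mu]] := simple_permute gi nsubmi s t.
  exists (eval f u); rewrite hE eiu xs; split=> //.
  by rewrite -(reprK c); apply/class_ofP; exists u, t.
Qed.

End Simple.

(** * Reduction to finitely many assignments *)

Definition truncate (n : nat) (k : nat) : loop_term :=
  if (k < n)%N then tvar k else tone.

(** Coding by functions between ordinals makes the assignments supported on the first [n] variables
    enumerable, with [x] listing the elements of [X]. *)
Definition extend (X : Type) (e : X) (n q : nat) (x : 'I_q -> X)
  (phi : {ffun 'I_n -> 'I_q}) (k : nat) : X :=
  if insub k is Some i then x (phi i) else e.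

Lemma extendP (X : loopType) (n q : nat) (x : 'I_q -> X) (e : nat -> X) :
    (forall y, exists i, x i = y) ->
  exists phi : {ffun 'I_n -> 'I_q},
    extend 1 x phi = fun k => eval e (truncate n k).
Proof.
move=> /choice[x' x'K]; exists [ffun i : 'I_n => x' (e i)].
apply/funext=> k; rewrite /extend /truncate.
by case: insubP => [i -> <-|/negbTE ->]; rewrite //= ffunE x'K.
Qed.

Lemma truncate_id (X : loopType) (n : nat) (f : nat -> X) :
  (forall k, (n <= k)%N -> f k = 1) -> (fun k => eval f (truncate n k)) = f.
Proof.
move=> f1; apply/funext=> k; rewrite /truncate; case: ltnP => //= nk.
by rewrite f1.
Qed.

Lemma finite_generates (X : loopType) :
    finitely_generated X ->
  exists n (f : nat -> X), generates f /\ forall k, (n <= k)%N -> f k = 1.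
Proof.
move=> [S [/finite_enumeration[n [x ->]] genS]].
(* The default 1 is the value of [tone], so that truncation fixes [f]. *)
pose f k := if insub k is Some i then x i else 1.
exists n, f; split=> [y|k nk]; last by rewrite /f insubN // -leqNgt.
have : [set: X] y by [].
rewrite -(genS (range_subloop f)) => [[t _ <-]|_ [i _ <-]]; first by exists t.
by exists (tvar i) => //=; rewrite /f valK.
Qed.

Lemma finite_finitely_generated (X : loopType) :
  finite_set [set: X] -> finitely_generated X.
Proof.
move=> finX; exists [set: X]; split=> // A AT.
by apply/seteqP; split=> // x _; apply: AT.
Qed.

End LoopTheory.

Theorem theorem5p4 (X : loopType) (finX : finite_set [set: X])
    (nonabX : ~ loop_abelian X) (simX : loop_simple X) :
  ~ proper_subloop_variety X X /\
  (forall L : loopType, finitely_generated L -> HSP X L ->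
     exists (k : nat) (Y : loopType),
       [/\ finite_set [set: Y],
           proper_subloop_variety X Y
         & loop_isomorphic L (X ^ k * Y)%type]).
Proof.
have [q [x [x' xK x'K]]] := finite_bijection _ finX.
have surjx y : exists i, x i = y by exists (x' y).
split=> [/generated_varietyP VX|L fgL /generated_varietyP VL].
  have [n [f [gf f1]]] := finite_generates (finite_finitely_generated finX).
  pose E := @extend X 1%g n q x.
  pose r := [seq phi <- enum {ffun 'I_n -> 'I_q} | `[< ~ generates (E phi) >]].
  have [s t er|phi] := @simple_prime_seq X nonabX simX _ E r f gf.
    (* Once the terms are truncated, an assignment into a proper subloop acts on them as some
       [E phi], which is in [r] because its values stay in that subloop. *)
    have /VX/(_ f) : forall A : loopType,
      (exists A0 : subloop X, subloop_proper A0 /\ A = subloop_type A0) ->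
      satisfies A (tsubst (truncate n) s) (tsubst (truncate n) t).
      move=> _ [A [properA ->]] e; apply: val_inj.
      rewrite !(eval_morphism _ _ (val_subloop_morphism A)).
      rewrite !eval_tsubst; have [phi ephi] := extendP n (val \o e) surjx.
      rewrite -ephi; apply: er; rewrite mem_filter mem_enum andbT.
      apply/asboolP=> gE; apply: properA; apply/seteqP; split=> // y _.
      have [u <-] := gE y; rewrite /E ephi -eval_tsubst.
      rewrite -(eval_morphism _ _ (val_subloop_morphism A)).
      exact: set_mem (valP _).
    by rewrite !eval_tsubst truncate_id.
  rewrite mem_filter => /andP[/asboolP ngE _] sub; apply: ngE.
  (* The kernel inclusion makes [eval (E phi) \o u] an injection of the finite loop [X] into itself,
     hence a surjection, so [E phi] would generate [X]. *)
  have [u fu] := choice gf.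
  move=> y; have [|v <-] := finite_inj_surj (eval (E phi) \o u) finX _ y.
    by move=> v w /sub; rewrite !fu.
  by exists (u v).
have [n [f [gf f1]]] := finite_generates fgL.
pose E := @extend X 1%g n q x.
have triv (u v : (X ^ 0)%type) : u = v by apply/ffunP=> -[].
(* Nothing is absorbed yet: [Z] starts as the one-element loop, and the family consists of all
   [E phi]. *)
apply: (@decomposition X nonabX simX _ E (enum {ffun 'I_n -> 'I_q}) finX
  (X ^ 0)%type L (fun=> 1%g) f) => //.
- by apply/generated_varietyP=> s t _ e; exact: triv.
- have -> : [set: (X ^ 0)%type] = [set 1%g].
    by apply/seteqP; split=> u _ //; exact: triv.
  exact: finite_set1.
- move=> s t er _.
  have /VL/(_ f) : forall Y : loopType, Y = X ->
    satisfies Y (tsubst (truncate n) s) (tsubst (truncate n) t).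
    move=> _ -> e; rewrite !eval_tsubst.
    have [phi <-] := extendP n e surjx.
    by apply: er; rewrite mem_enum.
  by rewrite !eval_tsubst truncate_id.
Qed.
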